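(* Let $S$ be a set, let $\mathbf{M}$ be an $S$-distributive monoidal category, and let $\mathbf{C}$ be an $\mathbf{M}$-category with object set $S$ that factorizes through the $\mathbf{M}$-subcategories $\mathbf{A}$ and $\mathbf{B}$ (both with object set $S$), with inclusion $\mathbf{M}$-functors $\alpha:\mathbf{A}\to\mathbf{C}$ and $\beta:\mathbf{B}\to\mathbf{C}$. For $x,y\in S$ let ${}_x\psi_y$ be the inverse of the isomorphism ${}_x\varphi_y:{}_xA_{\overline{u}}B_y\to{}_xC_y$, and for $x,y,z\in S$ put $${}_xR_z^y:={}_x\psi_z\circ{}_xc_z^y\circ({}_x\beta_y\otimes{}_y\alpha_z):{}_xB_y\otimes{}_yA_z\longrightarrow{}_xA_{\overline{u}}B_z .$$ Then the family $\{{}_xR_z^y\}_{x,y,z\in S}$ is a twisting system between $\mathbf{B}$ and $\mathbf{A}$.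
   Context: $(\mathbf{M},\otimes,\mathbf{1})$ is a monoidal category; associativity and unit constraints are suppressed, and the identity morphism of an object $X$ is also denoted $X$. $\mathbf{M}$ is $S$-distributive if every $S$-indexed family $\{X_i\}_{i\in S}$ of objects has a coproduct $(\bigoplus_{i\in S}X_i,\{\sigma_i\}_{i\in S})$ and, for every object $X$, $(X\otimes\bigoplus_iX_i,\{X\otimes\sigma_i\})$ and $((\bigoplus_iX_i)\otimes X,\{\sigma_i\otimes X\})$ are coproducts of $\{X\otimes X_i\}$ and $\{X_i\otimes X\}$. An $\mathbf{M}$-category $\mathbf{C}$ with object set $S$ consists of objects ${}_xC_y$ of $\mathbf{M}$ (playing the role of $\mathrm{Hom}(y,x)$), composition morphisms ${}_xc_z^y:{}_xC_y\otimes{}_yC_z\to{}_xC_z$ and identities $1_x:\mathbf{1}\to{}_xC_x$, satisfying the usual associativity and unit axioms. For $\mathbf{M}$-categories $\mathbf{A},\mathbf{B}$ these data are written ${}_xA_y,{}_xa_z^y,1_x^A$ and ${}_xB_y,{}_xb_z^y,1_x^B$. An $\mathbf{M}$-subcategory $\mathbf{A}$ of $\mathbf{C}$ with the same object set comes with an inclusion $\mathbf{M}$-functor that is the identity on objects, i.e. morphisms ${}_x\alpha_y:{}_xA_y\to{}_xC_y$ with ${}_x\alpha_x\circ1_x^A=1_x$ and ${}_xc_z^y\circ({}_x\alpha_y\otimes{}_y\alpha_z)={}_x\alpha_z\circ{}_xa_z^y$. Write ${}_xA_{\overline{u}}B_y:=\bigoplus_{u\in S}{}_xA_u\otimes{}_uB_y$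 with canonical inclusions ${}_x\sigma_y^u:{}_xA_u\otimes{}_uB_y\to{}_xA_{\overline{u}}B_y$. Let ${}_x\varphi_y:{}_xA_{\overline{u}}B_y\to{}_xC_y$ be the unique morphism with ${}_x\varphi_y\circ{}_x\sigma_y^u={}_xc_y^u\circ({}_x\alpha_u\otimes{}_u\beta_y)$ for all $u\in S$. $\mathbf{C}$ factorizes through $\mathbf{A}$ and $\mathbf{B}$ if ${}_x\varphi_y$ is an isomorphism for all $x,y\in S$. A twisting system between $\mathbf{B}$ and $\mathbf{A}$ is a family of morphisms ${}_xR_z^y:{}_xB_y\otimes{}_yA_z\to{}_xA_{\overline{u}}B_z$ ($x,y,z\in S$) such that for all $x,y,z,t\in S$: (T1) ${}_xR_t^z\circ({}_xb_z^y\otimes{}_zA_t)=\mathsf{b}\circ\big(\bigoplus_{u}{}_xR_u^y\otimes{}_uB_t\big)\circ({}_xB_y\otimes{}_yR_t^z)$, where $\bigoplus_u{}_xR_u^y\otimes{}_uB_t:{}_xB_y\otimes\bigoplus_u({}_yA_u\otimes{}_uB_t)\to\bigoplus_{u,v}{}_xA_v\otimes{}_vB_u\otimes{}_uB_t$, and $\mathsf{b}:\bigoplus_{u,v}{}_xA_v\otimes{}_vB_u\otimes{}_uB_t\to{}_xA_{\overline{v}}B_t$ restricts to ${}_x\sigma_t^v\circ({}_xA_v\otimes{}_vb_t^u)$ on the $(u,v)$ summand; (T2) ${}_xR_t^y\circ({}_xB_y\otimes{}_ya_t^z)=\mathsf{a}\circ\big(\bigoplus_v{}_xA_v\otimes{}_vR_t^z\big)\circ({}_xR_z^y\otimes{}_zA_t)$,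 where $\bigoplus_v{}_xA_v\otimes{}_vR_t^z:\bigoplus_v{}_xA_v\otimes{}_vB_z\otimes{}_zA_t\to\bigoplus_{u,v}{}_xA_v\otimes{}_vA_u\otimes{}_uB_t$, and $\mathsf{a}:\bigoplus_{u,v}{}_xA_v\otimes{}_vA_u\otimes{}_uB_t\to{}_xA_{\overline{u}}B_t$ restricts to ${}_x\sigma_t^u\circ({}_xa_u^v\otimes{}_uB_t)$ on the $(u,v)$ summand; (T3) ${}_xR_y^x\circ(1_x^B\otimes{}_xA_y)={}_x\sigma_y^y\circ({}_xA_y\otimes1_y^B)$; (T4) ${}_xR_y^y\circ({}_xB_y\otimes1_y^A)={}_x\sigma_y^x\circ(1_x^A\otimes{}_xB_y)$. *)

(* Defs.v *)
Set Implicit Arguments.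
Unset Strict Implicit.
Unset Printing Implicit Defensive.

Record category := Category {
  obj :> Type;
  hom : obj -> obj -> Type;
  idm : forall X, hom X X;
  comp : forall X Y Z, hom Y Z -> hom X Y -> hom X Z;
  comp_idl : forall X Y (f : hom X Y), comp (idm Y) f = f;
  comp_idr : forall X Y (f : hom X Y), comp f (idm X) = f;
  compA : forall W X Y Z (h : hom Y Z) (g : hom X Y) (f : hom W X),
    comp h (comp g f) = comp (comp h g) f
}.
Arguments hom {c} X Y.
Arguments idm {c} X.
Arguments comp {c X Y Z} g f.

Declare Scope cat_scope.
Delimit Scope cat_scope with cat.
Open Scope cat_scope.

Notation "g ∘ f" := (comp g f) (at level 40, left associativity) : cat_scope.

Definition inverse_of (M : category) (X Y : M) (f : hom X Y) (g : hom Y X) : Prop :=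
  g ∘ f = idm X /\ f ∘ g = idm Y.

Definition is_iso (M : category) (X Y : M) (f : hom X Y) : Prop :=
  exists g : hom Y X, inverse_of f g.

(* The constraints are kept explicit: [assoc X Y Z], [lunit X] and [runit X] are
   the associativity and unit isomorphisms, with inverses [assocV], [lunitV] and
   [runitV]. *)
Record monoidal := Monoidal {
  mcat :> category;
  tens : mcat -> mcat -> mcat;
  tensm : forall X X' Y Y' : mcat,
    hom X X' -> hom Y Y' -> hom (tens X Y) (tens X' Y');
  one : mcat;
  assoc : forall X Y Z, hom (tens (tens X Y) Z) (tens X (tens Y Z));
  assocV : forall X Y Z, hom (tens X (tens Y Z)) (tens (tens X Y) Z);
  lunit : forall X, hom (tens one X) X;
  lunitV : forall X, hom X (tens one X);
  runit : forall X, hom (tens X one) X;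
  runitV : forall X, hom X (tens X one);
  tensm_id : forall X Y, tensm (idm X) (idm Y) = idm (tens X Y);
  tensm_comp : forall X X' X'' Y Y' Y''
      (f : hom X X') (f' : hom X' X'') (g : hom Y Y') (g' : hom Y' Y''),
    tensm (f' ∘ f) (g' ∘ g) = tensm f' g' ∘ tensm f g;
  assoc_inv : forall X Y Z, inverse_of (assoc X Y Z) (assocV X Y Z);
  lunit_inv : forall X, inverse_of (lunit X) (lunitV X);
  runit_inv : forall X, inverse_of (runit X) (runitV X);
  assoc_nat : forall X X' Y Y' Z Z'
      (f : hom X X') (g : hom Y Y') (h : hom Z Z'),
    assoc X' Y' Z' ∘ tensm (tensm f g) h = tensm f (tensm g h) ∘ assoc X Y Z;
  lunit_nat : forall X X' (f : hom X X'),
    lunit X' ∘ tensm (idm one) f = f ∘ lunit X;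
  runit_nat : forall X X' (f : hom X X'),
    runit X' ∘ tensm f (idm one) = f ∘ runit X;
  pentagon : forall W X Y Z,
    assoc W X (tens Y Z) ∘ assoc (tens W X) Y Z
    = tensm (idm W) (assoc X Y Z) ∘ assoc W (tens X Y) Z
      ∘ tensm (assoc W X Y) (idm Z);
  triangle : forall X Y,
    tensm (idm X) (lunit Y) ∘ assoc X one Y = tensm (runit X) (idm Y)
}.
Arguments tens {m} X Y.
Arguments tensm {m X X' Y Y'} f g.
Arguments one {m}.
Arguments assoc {m} X Y Z.
Arguments assocV {m} X Y Z.
Arguments lunit {m} X.
Arguments lunitV {m} X.
Arguments runit {m} X.
Arguments runitV {m} X.

Notation "X ⊗ Y" := (tens X Y) (at level 34, left associativity) : cat_scope.
Notation "f ⊠ g" := (tensm f g) (at level 34, left associativity) : cat_scope.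

(* The mediating morphism is part of the data; [copair_uniq] determines it, so
   no choice is involved. *)
Record coproduct (M : category) (S : Type) (X : S -> M) (P : M)
    (i : forall s, hom (X s) P) := Coproduct {
  copair : forall Y, (forall s, hom (X s) Y) -> hom P Y;
  copair_in : forall Y (f : forall s, hom (X s) Y) s, copair f ∘ i s = f s;
  copair_uniq : forall Y (f : forall s, hom (X s) Y) (h : hom P Y),
    (forall s, h ∘ i s = f s) -> h = copair f
}.
Arguments copair {M S X P i} c {Y} f.

Record distributive (S : Type) (M : monoidal) := Distributive {
  bigsum : (S -> M) -> M;
  inj : forall (X : S -> M) s, hom (X s) (bigsum X);
  bigsumP : forall X : S -> M, coproduct (inj X);
  bigsum_tensl : forall (Y : M) (X : S -> M),
    coproduct (X := fun s => Y ⊗ X s) (fun s => idm Y ⊠ inj X s);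
  bigsum_tensr : forall (X : S -> M) (Y : M),
    coproduct (X := fun s => X s ⊗ Y) (fun s => inj X s ⊠ idm Y)
}.
Arguments bigsum {S M} d X.
Arguments inj {S M} d X s.
Arguments bigsumP {S M} d X.
Arguments bigsum_tensl {S M} d Y X.
Arguments bigsum_tensr {S M} d X Y.

Section SumMorphisms.
Variables (S : Type) (M : monoidal) (D : distributive S M).

Definition bigsum_case (X : S -> M) (Y : M) (f : forall s, hom (X s) Y) :
    hom (bigsum D X) Y :=
  copair (bigsumP D X) f.

Definition bigsum_map (X Y : S -> M) (f : forall s, hom (X s) (Y s)) :
    hom (bigsum D X) (bigsum D Y) :=
  bigsum_case (fun s => inj D Y s ∘ f s).

(* The canonical isomorphisms through which a tensor product with a coproduct
   is identified with the coproduct of the tensor products. *)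
Definition distl (Y : M) (X : S -> M) :
    hom (Y ⊗ bigsum D X) (bigsum D (fun s => Y ⊗ X s)) :=
  copair (bigsum_tensl D Y X) (inj D (fun s => Y ⊗ X s)).

Definition distr (X : S -> M) (Y : M) :
    hom (bigsum D X ⊗ Y) (bigsum D (fun s => X s ⊗ Y)) :=
  copair (bigsum_tensr D X Y) (inj D (fun s => X s ⊗ Y)).

End SumMorphisms.

(* [mhom C x y] is the object xCy, i.e. the morphisms from y to x, and
   [mcomp C x y z] is the composition xCy ⊗ yCz -> xCz. *)
Record enriched (S : Type) (M : monoidal) := Enriched {
  mhom : S -> S -> M;
  mcomp : forall x y z, hom (mhom x y ⊗ mhom y z) (mhom x z);
  mid : forall x, hom one (mhom x x);
  mcompA : forall x y z t,
    mcomp x z t ∘ (mcomp x y z ⊠ idm (mhom z t))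
    = mcomp x y t ∘ (idm (mhom x y) ⊠ mcomp y z t)
      ∘ assoc (mhom x y) (mhom y z) (mhom z t);
  mcomp_idl : forall x y,
    mcomp x x y ∘ (mid x ⊠ idm (mhom x y)) = lunit (mhom x y);
  mcomp_idr : forall x y,
    mcomp x y y ∘ (idm (mhom x y) ⊠ mid y) = runit (mhom x y)
}.
Arguments mhom {S M} e x y.
Arguments mcomp {S M} e x y z.
Arguments mid {S M} e x.

(* The M-functor exhibiting A as an M-subcategory of C with the same objects:
   the identity on objects.  The [incl x y] are not required to be monic. *)
Record inclusion (S : Type) (M : monoidal) (A C : enriched S M) := Inclusion {
  incl : forall x y, hom (mhom A x y) (mhom C x y);
  incl_id : forall x, incl x x ∘ mid A x = mid C x;
  incl_comp : forall x y z,
    mcomp C x y z ∘ (incl x y ⊠ incl y z) = incl x z ∘ mcomp A x y z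
}.
Arguments incl {S M A C} i x y.

Section Factorization.
Variables (S : Type) (M : monoidal) (D : distributive S M).

(* [AB A B x y] is the coproduct over u of xAu ⊗ uBy, and [sigma A B x u y] is
   the inclusion of its u-th summand. *)
Definition AB (A B : enriched S M) (x y : S) : M :=
  bigsum D (fun u => mhom A x u ⊗ mhom B u y).

Definition sigma (A B : enriched S M) (x u y : S) :
    hom (mhom A x u ⊗ mhom B u y) (AB A B x y) :=
  inj D (fun u => mhom A x u ⊗ mhom B u y) u.

Definition phi (A B C : enriched S M) (alpha : inclusion A C)
    (beta : inclusion B C) (x y : S) : hom (AB A B x y) (mhom C x y) :=
  bigsum_case D (fun u => mcomp C x u y ∘ (incl alpha x u ⊠ incl beta u y)).

Definition factorizes (A B C : enriched S M) (alpha : inclusion A C)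
    (beta : inclusion B C) : Prop :=
  forall x y, is_iso (phi alpha beta x y).

Section Twisting.
Variables A B : enriched S M.
Variable R : forall x y z, hom (mhom B x y ⊗ mhom A y z) (AB A B x z).

(* Coproducts over (u, v) are iterated S-indexed coproducts: outer index u in
   [sumRB] and [mulB], outer index v in [sumAR] and [mulA]. *)
Definition sumRB (x y t : S) :
    hom (mhom B x y ⊗ AB A B y t)
      (bigsum D (fun u => bigsum D (fun v =>
         (mhom A x v ⊗ mhom B v u) ⊗ mhom B u t))) :=
  bigsum_map D (fun u =>
    distr D (fun v => mhom A x v ⊗ mhom B v u) (mhom B u t)
    ∘ (R x y u ⊠ idm (mhom B u t))
    ∘ assocV (mhom B x y) (mhom A y u) (mhom B u t))
  ∘ distl D (mhom B x y) (fun u => mhom A y u ⊗ mhom B u t).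

Definition mulB (x t : S) :
    hom (bigsum D (fun u => bigsum D (fun v =>
           (mhom A x v ⊗ mhom B v u) ⊗ mhom B u t))) (AB A B x t) :=
  bigsum_case D (fun u => bigsum_case D (fun v =>
    sigma A B x v t
    ∘ (idm (mhom A x v) ⊠ mcomp B v u t)
    ∘ assoc (mhom A x v) (mhom B v u) (mhom B u t))).

Definition sumAR (x z t : S) :
    hom (AB A B x z ⊗ mhom A z t)
      (bigsum D (fun v => bigsum D (fun u =>
         mhom A x v ⊗ (mhom A v u ⊗ mhom B u t)))) :=
  bigsum_map D (fun v =>
    distl D (mhom A x v) (fun u => mhom A v u ⊗ mhom B u t)
    ∘ (idm (mhom A x v) ⊠ R v z t)
    ∘ assoc (mhom A x v) (mhom B v z) (mhom A z t))
  ∘ distr D (fun v => mhom A x v ⊗ mhom B v z) (mhom A z t).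

Definition mulA (x t : S) :
    hom (bigsum D (fun v => bigsum D (fun u =>
           mhom A x v ⊗ (mhom A v u ⊗ mhom B u t)))) (AB A B x t) :=
  bigsum_case D (fun v => bigsum_case D (fun u =>
    sigma A B x u t
    ∘ (mcomp A x v u ⊠ idm (mhom B u t))
    ∘ assocV (mhom A x v) (mhom A v u) (mhom B u t))).

Record twisting_system : Prop := TwistingSystem {
  twist_mulB : forall x y z t,
    R x z t ∘ (mcomp B x y z ⊠ idm (mhom A z t))
    = mulB x t ∘ sumRB x y t ∘ (idm (mhom B x y) ⊠ R y z t)
      ∘ assoc (mhom B x y) (mhom B y z) (mhom A z t);
  twist_mulA : forall x y z t,
    R x y t ∘ (idm (mhom B x y) ⊠ mcomp A y z t)
    = mulA x t ∘ sumAR x z t ∘ (R x y z ⊠ idm (mhom A z t))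
      ∘ assocV (mhom B x y) (mhom A y z) (mhom A z t);
  twist_unitB : forall x y,
    R x x y ∘ (mid B x ⊠ idm (mhom A x y)) ∘ lunitV (mhom A x y)
    = sigma A B x y y ∘ (idm (mhom A x y) ⊠ mid B y) ∘ runitV (mhom A x y);
  twist_unitA : forall x y,
    R x y y ∘ (idm (mhom B x y) ⊠ mid A y) ∘ runitV (mhom B x y)
    = sigma A B x x y ∘ (mid A x ⊠ idm (mhom B x y)) ∘ lunitV (mhom B x y)
}.

End Twisting.
End Factorization.

(* Main.v *)
(* Write ⟨f, g⟩ for c ∘ (f ⊗ g), so that φ is the copairing of the ⟨α, β⟩ and
   φ ∘ R = ⟨β, α⟩.  As φ is an isomorphism, the axioms may be checked after
   composing with φ.  Checked on the coproduct injections, φ turns the composite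
   b ∘ ⊕R of (T1) into ⟨β, φ⟩ and the composite a ∘ ⊕R of (T2) into ⟨φ, α⟩;
   both axioms then reduce to associativity of ⟨-, -⟩, while (T3) and (T4) become
   ⟨1, α⟩ = α = ⟨α, 1⟩ and ⟨β, 1⟩ = β = ⟨1, β⟩. *)
Require Import Defs.
From Corelib Require Import ssreflect.

Lemma inverse_of_monic (M : category) (X Y : M) (f : hom X Y) (g : hom Y X) :
  inverse_of f g ->
  forall (W : M) (h k : hom W X), f ∘ h = f ∘ k -> h = k.
Proof.
move=> [gf _] W h k fhk.
by rewrite -(comp_idl h) -(comp_idl k) -gf -!compA fhk.
Qed.

Lemma coproduct_ext (M : category) (S : Type) (X : S -> M) (P : M)
    (i : forall s, hom (X s) P) (cP : coproduct i) (Y : M) (h k : hom P Y) :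
  (forall s, h ∘ i s = k ∘ i s) -> h = k.
Proof.
move=> hk; rewrite (copair_uniq cP hk).
by rewrite -(copair_uniq cP (fun s => eq_refl (k ∘ i s))).
Qed.

Section Mediating.
Variables (S : Type) (M : monoidal) (D : distributive S M).

Lemma bigsum_case_inj (X : S -> M) (Y : M) (f : forall s, hom (X s) Y) s :
  bigsum_case D f ∘ inj D X s = f s.
Proof. exact: copair_in. Qed.

Lemma bigsum_map_inj (X Y : S -> M) (f : forall s, hom (X s) (Y s)) s :
  bigsum_map D f ∘ inj D X s = inj D Y s ∘ f s.
Proof. exact: bigsum_case_inj. Qed.

Lemma distl_inj (Y : M) (X : S -> M) s :
  distl D Y X ∘ (idm Y ⊠ inj D X s) = inj D (fun s => Y ⊗ X s) s.
Proof. exact: (copair_in (bigsum_tensl D Y X)). Qed.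

Lemma distr_inj (X : S -> M) (Y : M) s :
  distr D X Y ∘ (inj D X s ⊠ idm Y) = inj D (fun s => X s ⊗ Y) s.
Proof. exact: (copair_in (bigsum_tensr D X Y)). Qed.

End Mediating.

Section Composition.
Variables (S : Type) (M : monoidal) (C : enriched S M).

(** Associativity of ⟨-, -⟩ on arbitrary morphisms into the hom objects: [mcompA] transported along
    the naturality of [assoc]. *)
Lemma mcomp_tensmA x y z t (X Y Z : M) (f : hom X (mhom C x y))
    (g : hom Y (mhom C y z)) (h : hom Z (mhom C z t)) :
  mcomp C x z t ∘ ((mcomp C x y z ∘ (f ⊠ g)) ⊠ h)
  = mcomp C x y t ∘ (f ⊠ (mcomp C y z t ∘ (g ⊠ h))) ∘ assoc X Y Z.
Proof.
(* Identities are inserted so that the interchange law can split off the inner composition on each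
   side. *)
rewrite -{1}(comp_idl h) -{2}(comp_idl f) !tensm_comp.
by rewrite !compA mcompA -!compA assoc_nat.
Qed.

Lemma mcomp_tensmAV x y z t (X Y Z : M) (f : hom X (mhom C x y))
    (g : hom Y (mhom C y z)) (h : hom Z (mhom C z t)) :
  mcomp C x z t ∘ ((mcomp C x y z ∘ (f ⊠ g)) ⊠ h) ∘ assocV X Y Z
  = mcomp C x y t ∘ (f ⊠ (mcomp C y z t ∘ (g ⊠ h))).
Proof.
by rewrite mcomp_tensmA -compA (proj2 (assoc_inv X Y Z)) comp_idr.
Qed.

(** Splitting 1 ⊠ f as (1 ⊠ id) ∘ (id ⊠ f) leaves the unit law of [C] and the naturality of
    [lunit]. *)
Lemma mcomp_mid_l x y (X : M) (f : hom X (mhom C x y)) :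
  mcomp C x x y ∘ (mid C x ⊠ f) ∘ lunitV X = f.
Proof.
rewrite -(comp_idr (mid C x)) -{1}(comp_idl f) tensm_comp compA mcomp_idl.
by rewrite lunit_nat -compA (proj2 (lunit_inv X)) comp_idr.
Qed.

Lemma mcomp_mid_r x y (X : M) (f : hom X (mhom C x y)) :
  mcomp C x y y ∘ (f ⊠ mid C y) ∘ runitV X = f.
Proof.
rewrite -(comp_idr (mid C y)) -{1}(comp_idl f) tensm_comp compA mcomp_idr.
by rewrite runit_nat -compA (proj2 (runit_inv X)) comp_idr.
Qed.

End Composition.

Section Factorization.
Variables (S : Type) (M : monoidal) (D : distributive S M).
Variables (C A B : enriched S M) (alpha : inclusion A C) (beta : inclusion B C).
Notation phi := (phi D alpha beta).

Lemma phi_sigma x u y :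
  phi x y ∘ sigma D A B x u y = mcomp C x u y ∘ (incl alpha x u ⊠ incl beta u y).
Proof. exact: (bigsum_case_inj _ _ D). Qed.

(** Handles the inner sum of [mulB] for fixed u. On the v-th injection both sides are ⟨α, β ∘ b⟩ ∘
    [assoc], because ⟨β, β⟩ = β ∘ b by functoriality of β. *)
Lemma phi_mulB_summand x u t :
  phi x t ∘ bigsum_case D (fun v => sigma D A B x v t
      ∘ (idm (mhom A x v) ⊠ mcomp B v u t)
      ∘ assoc (mhom A x v) (mhom B v u) (mhom B u t))
    ∘ distr D (fun v => mhom A x v ⊗ mhom B v u) (mhom B u t)
  = mcomp C x u t ∘ (phi x u ⊠ incl beta u t).
Proof.
apply: (coproduct_ext _ _ _ _ _ (bigsum_tensr D _ _)) => v.
rewrite /= -!compA (distr_inj _ _ _ _ _ v) (bigsum_case_inj _ _ _ _ _ _ v) -tensm_comp comp_idr.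
rewrite -/(sigma D A B x v u) phi_sigma mcomp_tensmA incl_comp !compA phi_sigma.
by rewrite -(compA (mcomp C x v t)) -tensm_comp comp_idr.
Qed.

(** Mirror image: on the u-th injection both sides are ⟨α ∘ a, β⟩ ∘ [assocV], by functoriality of
    α. *)
Lemma phi_mulA_summand x v t :
  phi x t ∘ bigsum_case D (fun u => sigma D A B x u t
      ∘ (mcomp A x v u ⊠ idm (mhom B u t))
      ∘ assocV (mhom A x v) (mhom A v u) (mhom B u t))
    ∘ distl D (mhom A x v) (fun u => mhom A v u ⊗ mhom B u t)
  = mcomp C x v t ∘ (incl alpha x v ⊠ phi v t).
Proof.
apply: (coproduct_ext _ _ _ _ _ (bigsum_tensl D _ _)) => u.
rewrite /= -!compA (distl_inj _ _ _ _ _ u) (bigsum_case_inj _ _ _ _ _ _ u) -tensm_comp comp_idr.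
rewrite -/(sigma D A B v u t) phi_sigma -mcomp_tensmAV incl_comp !compA phi_sigma.
by rewrite -(compA (mcomp C x u t)) -tensm_comp comp_idr.
Qed.

Variable R : forall x y z, hom (mhom B x y ⊗ mhom A y z) (AB D A B x z).
Hypothesis phi_R : forall x y z,
  phi x z ∘ R x y z = mcomp C x y z ∘ (incl beta x y ⊠ incl alpha y z).

(** On the u-th injection the inner sum collapses to ⟨φ ∘ R, β⟩ ∘ [assocV], that is ⟨⟨β, α⟩, β⟩ ∘
    [assocV] = ⟨β, ⟨α, β⟩⟩, and ⟨α, β⟩ is φ on that summand. *)
Lemma phi_mulB_sumRB x y t :
  phi x t ∘ mulB D A B x t ∘ sumRB R x y t
  = mcomp C x y t ∘ (incl beta x y ⊠ phi y t).
Proof.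
apply: (coproduct_ext _ _ _ _ _ (bigsum_tensl D _ _)) => u.
rewrite /= -!compA (distl_inj _ _ _ _ _ u) (bigsum_map_inj _ _ _ _ _ _ u) (compA (mulB _ _ _ _ _)).
rewrite (bigsum_case_inj _ _ _ _ _ _ u) !compA phi_mulB_summand.
rewrite -(compA (mcomp C x u t)) -tensm_comp comp_idr phi_R mcomp_tensmAV.
by rewrite -compA -tensm_comp comp_idr -/(sigma D A B y u t) phi_sigma.
Qed.

Lemma phi_mulA_sumAR x z t :
  phi x t ∘ mulA D A B x t ∘ sumAR R x z t
  = mcomp C x z t ∘ (phi x z ⊠ incl alpha z t).
Proof.
apply: (coproduct_ext _ _ _ _ _ (bigsum_tensr D _ _)) => v.
rewrite /= -!compA (distr_inj _ _ _ _ _ v) (bigsum_map_inj _ _ _ _ _ _ v) (compA (mulA _ _ _ _ _)).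
rewrite (bigsum_case_inj _ _ _ _ _ _ v) !compA phi_mulA_summand.
rewrite -(compA (mcomp C x v t)) -tensm_comp comp_idr phi_R -mcomp_tensmA.
by rewrite -compA -tensm_comp comp_idr -/(sigma D A B x v z) phi_sigma.
Qed.

Lemma twisting_system_of_phi :
  (forall x y (W : M) (h k : hom W (AB D A B x y)),
    phi x y ∘ h = phi x y ∘ k -> h = k) ->
  twisting_system R.
Proof.
move=> phi_monic; split=> [x y z t|x y z t|x y|x y]; apply: phi_monic.
(* (T1) becomes ⟨β ∘ b, α⟩ = ⟨β, ⟨β, α⟩⟩ ∘ [assoc]. *)
- rewrite !(compA (phi x t)) phi_mulB_sumRB phi_R.
  rewrite -!(compA (mcomp C _ _ _)) -!tensm_comp !comp_idr phi_R.
  by rewrite -incl_comp compA mcomp_tensmA -compA.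
(* (T2) becomes ⟨β, α ∘ a⟩ = ⟨⟨β, α⟩, α⟩ ∘ [assocV]. *)
- rewrite !(compA (phi x t)) phi_mulA_sumAR phi_R.
  rewrite -(compA (mcomp C x y t)) -(compA (mcomp C x z t) (phi x z ⊠ _)).
  by rewrite -!tensm_comp !comp_idr phi_R -incl_comp mcomp_tensmAV.
- rewrite !compA phi_R phi_sigma -!(compA (mcomp C _ _ _)) -!tensm_comp.
  by rewrite !incl_id !comp_idr !compA mcomp_mid_l mcomp_mid_r.
- rewrite !compA phi_R phi_sigma -!(compA (mcomp C _ _ _)) -!tensm_comp.
  by rewrite !incl_id !comp_idr !compA mcomp_mid_l mcomp_mid_r.
Qed.

End Factorization.

Theorem theorem2p3 (S : Type) (M : monoidal) (D : distributive S M)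
    (C A B : enriched S M) (alpha : inclusion A C) (beta : inclusion B C)
    (factorC : factorizes D alpha beta)
    (psi : forall x y, hom (mhom C x y) (AB D A B x y))
    (psiP : forall x y, inverse_of (phi D alpha beta x y) (psi x y)) :
  twisting_system (fun x y z =>
    psi x z ∘ mcomp C x y z ∘ (incl beta x y ⊠ incl alpha y z)).
Proof.
apply: (twisting_system_of_phi _ _ _ _ _ _ alpha beta) => [x y z|x y].
(* The two halves of invertibility are used separately: φ ∘ ψ = id gives φ ∘ R = ⟨β, α⟩, and ψ ∘ φ =
   id makes φ monic. *)
- by rewrite !compA (proj2 (psiP x z)) comp_idl.
- exact: (inverse_of_monic _ _ _ _ _ (psiP x y)).
Qed.
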